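(* Let $G$ be a finite graph and $\mathcal L$ a non-trivial linear class of bonds of $G$. Then the circuits of the complete join matroid $J_0(G,\mathcal L)$ are exactly: (1) the sets $J\cup\{e_0\}$ where $J$ is an $\mathcal L$-join, and (2) the edge sets of cycles of $G$.
   Context: Graphs are finite, loops and multiple edges allowed. A bond is a minimal nonempty edge cut; $\delta(X)$ is the set of links with exactly one endpoint in a vertex set $X$. A tribond is $\delta(X_1)\cup\delta(X_2)\cup\delta(X_3)$ for a partition $\{X_1,X_2,X_3\}$ of the vertex set of one connected component into nonempty sets with each $G[X_i]$ connected and an edge joining each pair. A linear class of bonds is a set $\mathcal L$ of bonds such that for each such tripartition the number of $i$ with $\delta(X_i)\in\mathcal L$ is never exactly two; it is trivial if it contains every bond; bonds in $\mathcal L$ are cobalanced. A modular pair of bonds $B_1,B_2$ is one for which $G-(B_1\cup B_2)$ has two more components than $G$; a dibond is the union of a modular pair that is not a tribond. For non-trivial $\mathcal L$, $J_0(G,\mathcal L)$ is the matroid on $E(G)\cup\{e_0\}$ whose cocircuits are the bonds in $\mathcal L$, the sets $B\cup\{e_0\}$ for bonds $B\notin\mathcal L$, and the tribonds and dibonds containing no bond of $\mathcal L$. For $F\subseteq E(G)$, $\pi_F$ is the partition of $V(G)$ into vertex sets of the components of $(V(G),F)$; $\mathrm{Ext}(\pi)$ is the set of edges whose endpoints lie in different parts of $\pi$; $\pi$ is cobalanced if every bond contained in $\mathrm{Ext}(\pi)$ lies in $\mathcal L$. An $\mathcal L$-join is the edge set $J$ of a forest of $G$ such that $\pi_J$ is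 cobalanced and $J$ is minimal (under inclusion) among forests with this property. *)

(* Defs.v *)
From mathcomp Require Export all_boot.

Set Implicit Arguments.
Unset Strict Implicit.
Unset Printing Implicit Defensive.

(** * Matroids on a finite type, given by their bases *)

Record matroid (T : finType) := Matroid {
  bases : {set {set T}};
  bases_neq0 : bases != set0;
  bases_exchange : forall A B x, A \in bases -> B \in bases -> x \in A :\: B ->
    exists2 y, y \in B :\: A & y |: (A :\ x) \in bases
}.

Section MatroidTheory.
Variables (T : finType) (M : matroid T).

Lemma exchange_card (A B : {set T}) (x y : T) :
  x \in A :\: B -> y \in B :\: A -> #|y |: (A :\ x)| = #|A|.
Proof.
move=> /setDP[xA xB] /setDP[yB yA].
by rewrite cardsU1 !inE (negPf yA) andbF (cardsD1 x A) xA.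
Qed.

Lemma exchange_measure (A B : {set T}) (x y : T) :
  x \in A :\: B -> y \in B :\: A -> #|(y |: (A :\ x)) :\: B| < #|A :\: B|.
Proof.
move=> xAB /setDP[yB yA]; apply: proper_card; apply/properP; split.
  by apply/subsetP=> z; rewrite !inE; case: eqVneq => [->|_]; rewrite ?yB //=
    => /andP[-> /andP[_ ->]].
exists x => //; rewrite !inE eqxx /=; case: eqVneq => [xy|]; last by rewrite andbF.
by move: xAB; rewrite xy inE yB.
Qed.

Lemma card_bases_le (A B : {set T}) :
  A \in bases M -> B \in bases M -> #|A| <= #|B|.
Proof.
have [n] := ubnP #|A :\: B|; elim: n => // n IH in A *; rewrite ltnS => leAn Ab Bb.
have [/eqP|[x xAB]] := set_0Vmem (A :\: B).
  by rewrite setD_eq0; apply: subset_leq_card.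
have [y yBA Cb] := bases_exchange Ab Bb xAB.
rewrite -(exchange_card xAB yBA); apply: IH => //.
exact: leq_trans (exchange_measure xAB yBA) leAn.
Qed.

Lemma card_bases (A B : {set T}) :
  A \in bases M -> B \in bases M -> #|A| = #|B|.
Proof. by move=> Ab Bb; apply/eqP; rewrite eqn_leq !card_bases_le. Qed.

Lemma bases_coexchange (A B C : {set T}) x :
    A \in bases M -> B \in bases M -> C \in bases M ->
    x \in B :\: A -> x \in C -> A :&: B \subset C -> C \subset A :|: B ->
  exists2 y, y \in A :\: B & x |: (A :\ y) \in bases M.
Proof.
have [n] := ubnP #|C :\: A|; elim: n => // n IH in C *.
rewrite ltnS => leCn Ab Bb Cb xBA xC sIC sCU; have [xB xA] := setDP xBA.
have [sCA|[z /setDP[zCA]]] := set_0Vmem ((C :\: A) :\ x); last first.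
  rewrite inE => zx; have [y yAC Db] := bases_exchange Cb Ab zCA.
  have [zC zA] := setDP zCA; have [yA yC] := setDP yAC.
  apply: (IH (y |: (C :\ z))) => //.
  - exact: leq_trans (exchange_measure zCA yAC) leCn.
  - by rewrite !inE xC andbT (eq_sym x z) zx orbT.
  - apply/subsetP=> w wI; rewrite !inE (subsetP sIC) // andbT.
    case: (eqVneq w z) wI => [->|_ _]; first by rewrite inE (negPf zA).
    by rewrite orbT.
  - apply/subsetP=> w; rewrite !inE => /orP[/eqP->|/andP[_ /(subsetP sCU)]].
      by rewrite yA.
    by rewrite inE.
have sCxA : C \subset x |: A.
  apply/subsetP=> w wC; rewrite !inE; apply/norP=> -[wx wA].
  by have := in_set0 w; rewrite -sCA !inE wx wA wC.
have [y /setDP[yA yC]] : exists y, y \in A :\: C.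
  apply/set0Pn; rewrite setD_eq0; apply/negP=> sAC.
  have : #|x |: A| <= #|C| by rewrite subset_leq_card // subUset sub1set xC.
  by rewrite cardsU1 xA (card_bases Cb Ab) ltnn.
have yB : y \notin B.
  by apply: contra yC => yB; apply: (subsetP sIC); rewrite inE yA.
have yAB : y \in A :\: B by rewrite inE yA yB.
exists y => //; suff -> : x |: (A :\ y) = C by [].
apply/eqP; rewrite eq_sym eqEcard (exchange_card yAB xBA) (card_bases Cb Ab) leqnn andbT.
apply/subsetP=> w wC; move/(subsetP sCxA): (wC); rewrite !inE.
case/orP=> [->//|->]; rewrite andbT; apply/orP; right.
by apply: contraNneq yC => <-.
Qed.

Fact dual_bases_neq0 : [set ~: B | B in bases M] != set0.
Proof.
by have /set0Pn[B Bb] := bases_neq0 M; apply/set0Pn; exists (~: B); apply: imset_f.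
Qed.

Fact dual_bases_exchange (A B : {set T}) x :
    A \in [set ~: B | B in bases M] -> B \in [set ~: B | B in bases M] ->
    x \in A :\: B ->
  exists2 y, y \in B :\: A & y |: (A :\ x) \in [set ~: B | B in bases M].
Proof.
case/imsetP=> A' Ab -> /imsetP[B' Bb ->]; rewrite setDE setCK setIC -setDE => xBA.
have [xB xA] : x \in B' /\ x \notin A' by case/setDP: xBA.
have [||y yAB Cb] :=
  bases_coexchange Ab Bb Bb xBA xB; rewrite ?subsetIr ?subsetUr //.
have [yA yB] := setDP yAB; exists y; first by rewrite !inE yA yB.
apply/imsetP; exists (x |: (A' :\ y)) => //; apply/setP=> w; rewrite !inE.
rewrite negb_or negb_and negbK; case: eqVneq => [->|//]; rewrite andbT.
by apply/esym; apply: contraNneq xA => <-.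
Qed.

Definition dual_matroid : matroid T := Matroid dual_bases_neq0 dual_bases_exchange.

Definition independent (I : {set T}) : bool := [exists B in bases M, I \subset B].

Definition circuit (C : {set T}) : bool := minset (fun S => ~~ independent S) C.

End MatroidTheory.

Definition cocircuit (T : finType) (M : matroid T) (D : {set T}) : bool :=
  circuit (dual_matroid M) D.

(** * Finite graphs with loops and multiple edges *)

(* An edge with one end is a loop, an edge with two ends is a link. *)
Record graph := Graph {
  vertex : finType;
  edge : finType;
  ends : edge -> {set vertex};
  ends_card : forall e, 0 < #|ends e| <= 2
}.

Section GraphTheory.
Variable G : graph.
Local Notation V := (vertex G).
Local Notation E := (edge G).

Implicit Types (F B D J : {set E}) (X K : {set V}) (P : {set {set V}}).
Implicit Types L : {set {set E}}.

Definition adj F : rel V := fun u v => [exists e in F, ends e == [set u; v]].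

(* The partition pi_F of V(G) into the components of (V(G), F). *)
Definition comp_partition F : {set {set V}} :=
  equivalence_partition (connect (adj F)) [set: V].

Definition induced_edges X : {set E} := [set e | ends e \subset X].

Definition connected_in X : bool :=
  (X != set0) &&
  [forall u in X, forall v in X, connect (adj (induced_edges X)) u v].

Definition delta X : {set E} :=
  [set e | (#|ends e| == 2) && (#|ends e :&: X| == 1)].

Definition edge_cut D : bool := [exists X, D == delta X].

Definition bond B : bool := minset (fun D => (D != set0) && edge_cut D) B.

Definition tripartition P : bool :=
  [&& [exists K in comp_partition [set: E], partition P K],
      #|P| == 3,
      [forall X in P, connected_in X]
    & [forall X in P, forall Y in P, (X != Y) ==>
        [exists x in X, exists y in Y, adj [set: E] x y]]].

Definition tribond D : bool :=
  [exists P, tripartition P && (D == \bigcup_(X in P) delta X)].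

Definition modular_pair B1 B2 : bool :=
  [&& bond B1, bond B2
    & #|comp_partition (~: (B1 :|: B2))| == #|comp_partition [set: E]| + 2].

Definition dibond D : bool :=
  [exists B1, exists B2, modular_pair B1 B2 && (D == B1 :|: B2)] && ~~ tribond D.

Definition linear_class L : Prop :=
  (forall B, B \in L -> bond B) /\
  (forall P, tripartition P -> #|[set X in P | delta X \in L]| != 2).

Definition trivial_class L : Prop := forall B, bond B -> B \in L.

(* The ground set E(G) + e_0 is [option (edge G)], with [None] as e_0. *)
Definition lift_set F : {set option E} := [set Some e | e in F].
Definition lift_set0 F : {set option E} := None |: lift_set F.

Definition join_cocircuit L (D : {set option E}) : Prop :=
  [\/ exists2 B, bond B && (B \in L) & D = lift_set B,
      exists2 B, bond B && (B \notin L) & D = lift_set0 B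
    | exists2 T, (tribond T || dibond T) &&
                 [forall B in L, ~~ (B \subset T)] & D = lift_set T].

Definition complete_join_matroid L (M : matroid (option E)) : Prop :=
  forall D : {set option E}, cocircuit M D <-> join_cocircuit L D.

Definition Ext P : {set E} :=
  [set e | [exists u in ends e, exists v in ends e, pblock P u != pblock P v]].

Definition cobalanced L P : Prop :=
  forall B, bond B -> B \subset Ext P -> B \in L.

(* The cycle v_0 e_0 v_1 ... v_(k-1) e_(k-1) v_0, for k > 0; a loop is a cycle
   with k = 1, and a pair of parallel links one with k = 2. *)
Definition cycle_edges F : Prop :=
  exists k (v : 'I_k -> V) (e : 'I_k -> E),
    [/\ 0 < k, injective v, injective e,
        forall i, ends (e i) = [set v i; v (ordS i)]
      & F = [set e i | i : 'I_k]].

Definition forest_edges F : Prop := forall D, cycle_edges D -> ~~ (D \subset F).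

Definition L_join L J : Prop :=
  [/\ forest_edges J, cobalanced L (comp_partition J)
    & forall J', forest_edges J' -> cobalanced L (comp_partition J') ->
        J' \subset J -> J' = J].

End GraphTheory.

(* Main.v *)
Require Import Defs.

(** A set is independent in a matroid iff no circuit lies in it, and a circuit
    never meets a cocircuit in one element.  Every cocircuit of the complete
    join matroid traces on [E(G)] a union of edge cuts, and a cycle never meets
    a cut in exactly one edge, so cycles are dependent; conversely an edge [x]
    of a forest [F] is the only edge of [F] in some bond [B], and [B] or
    [B + e_0] is a cocircuit, so forests are independent.  Given a forest [F],
    [F + e_0] is then independent iff some cocircuit through [e_0] avoids [F],
    and this cocircuit must be [B + e_0] for a bond [B] outside [L] that avoids
    [F], i.e. lies in [Ext(pi_F)].  That [M] is given as a matroid replaces any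
    analysis of the tribonds and dibonds. *)

Set Implicit Arguments.
Unset Strict Implicit.
Unset Printing Implicit Defensive.

(** * Orthogonality of circuits and cocircuits, and fundamental cocircuits *)

Section Matroids.
Variable T : finType.
Implicit Types (M : matroid T) (A B C D I : {set T}).

Lemma independentP M I :
  reflect (exists2 B, B \in bases M & I \subset B) (independent M I).
Proof. exact: exists_inP. Qed.

Lemma independentS M I A : A \subset I -> independent M I -> independent M A.
Proof.
move=> sAI /independentP[B Bb sIB]; apply/independentP; exists B => //.
exact: subset_trans sAI sIB.
Qed.

Lemma independent_dualP M D :
  reflect (forall B, B \in bases M -> exists2 x, x \in B & x \in D)
    (~~ independent (dual_matroid M) D).
Proof.
apply: (iffP idP) => [Ddep B Bb | Dmeets].
  have /set0Pn[x /setIP[xB xD]] : B :&: D != set0.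
    apply: contra Ddep => BD0; apply/independentP; exists (~: B).
      exact: imset_f.
    by rewrite -disjoints_subset disjoint_sym -setI_eq0.
  by exists x.
apply/negP => /independentP[_ /imsetP[B Bb ->] sDB].
by have [x xB /(subsetP sDB)] := Dmeets B Bb; rewrite inE xB.
Qed.

(** Starting from a basis containing [I], each element outside [I :|: B] is exchanged for an element
    of [B]; no element of [I] is ever removed, and [A :\: (I :|: B)] shrinks. *)
Lemma independent_augment M I B :
    independent M I -> B \in bases M ->
  exists A, [/\ A \in bases M, I \subset A & A \subset I :|: B].
Proof.
case/independentP => A Ab sIA Bb.
have [n] := ubnP #|A :\: (I :|: B)|; elim: n => // n IH in A Ab sIA *.
rewrite ltnS => leAn.
have [/eqP|[z]] := set_0Vmem (A :\: (I :|: B)).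
  by rewrite setD_eq0 => sA; exists A.
rewrite !inE negb_or -andbA => /and3P[zI zB zA].
have zAB : z \in A :\: B by rewrite inE zB.
have [y yBA A'b] := bases_exchange Ab Bb zAB.
have /setDP[yB yA] := yBA.
apply: (IH _ A'b).
  apply/subsetP => w wI; rewrite !inE (subsetP sIA) // andbT.
  by rewrite (memPn zI) // orbT.
apply: leq_trans leAn; apply: proper_card; apply/properP; split.
  apply/subsetP => w; rewrite !inE negb_or.
  by case: eqVneq => [->|_] /=; rewrite ?yB ?andbF // => /andP[-> /andP[]].
exists z; rewrite !inE ?negb_or ?zI ?zB //= eqxx /= orbF.
by apply: contraNneq zB => ->.
Qed.

(** By minimality [C :\ x] is independent and some basis [B] avoids [D :\ x]. Augmenting [C :\ x]
    from [B] gives a basis [A] that can meet [D] only in [x]. As [D] meets every basis, [x] is in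
    [A], so [A] contains the dependent set [C]. *)
Lemma circuit_orthogonal M C D x :
  circuit M C -> cocircuit M D -> C :&: D <> [set x].
Proof.
case/minsetP => Cdep Cmin /minsetP[/independent_dualP Dmeets Dmin] CDx.
have /setIP[xC xD] : x \in C :&: D by rewrite CDx set11.
have Cx : independent M (C :\ x).
  apply: contraLR xC => dep.
  by rewrite -(Cmin _ dep (subsetDl _ _)) !inE eqxx.
have : independent (dual_matroid M) (D :\ x).
  apply: contraLR xD => dep.
  by rewrite -(Dmin _ dep (subsetDl _ _)) !inE eqxx.
case/independentP => _ /imsetP[B Bb ->] sDB.
have [A [Ab sCA sAU]] := independent_augment Cx Bb.
have [y yA yD] := Dmeets A Ab.
have yx : y = x.
  apply/eqP; apply/negPn/negP => yx.
  have := subsetP sAU y yA; rewrite !inE yx /=; case/orP => [yC|yB].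
    by have := in_setI y C D; rewrite CDx yC yD inE (negPf yx).
  by have := subsetP sDB y; rewrite !inE yx yD yB => /(_ isT).
case/negP: Cdep; apply/independentP; exists A => //.
by rewrite -(setD1K xC) subUset sub1set sCA -yx yA.
Qed.

(** For a basis [B] containing [I], the set [B :\ x] is too small to contain a basis, so its
    complement meets every basis and contains a cocircuit. This cocircuit must meet [B], and can do
    so only in [x]. *)
Lemma fundamental_cocircuit M I x :
  independent M I -> x \in I -> exists2 D, cocircuit M D & I :&: D = [set x].
Proof.
case/independentP => B Bb sIB xI; have xB := subsetP sIB x xI.
have : ~~ independent (dual_matroid M) (~: (B :\ x)).
  apply/independent_dualP => A Ab.
  have /subsetPn[y yA yB] : ~~ (A \subset B :\ x).
    apply/negP => /subset_leq_card; rewrite (card_bases Ab Bb).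
    by rewrite (cardsD1 x B) xB ltnn.
  by exists y; rewrite // inE.
case/(@minset_exists _ (fun S => ~~ independent (dual_matroid M) S)) => D Dmin sD.
exists D => //.
have sub z : z \in B -> z \in D -> z = x.
  move=> zB /(subsetP sD); rewrite !inE zB andbT negbK; exact: eqP.
have /independent_dualP/(_ B Bb)[y yB yD] := minsetp Dmin.
have xD : x \in D by rewrite -(sub y yB yD).
apply/setP => z; rewrite !inE; apply/andP/eqP => [[/(subsetP sIB)]|-> //].
exact: sub.
Qed.

Lemma dependent_circuit M A :
  ~~ independent M A -> exists2 C, circuit M C & C \subset A.
Proof.
by case/(@minset_exists _ (fun S => ~~ independent M S)) => C; exists C.
Qed.

Lemma circuit_neq0 M C : circuit M C -> C != set0.
Proof.
move/minsetp; apply: contraNneq => ->; apply/independentP.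
by have /set0Pn[B Bb] := bases_neq0 M; exists B; rewrite ?sub0set.
Qed.

End Matroids.

(** * Cycles against cuts *)

Section Graphs.
Variable G : graph.
Local Notation V := (vertex G).
Local Notation E := (edge G).
Implicit Types (F B D Z : {set E}) (X Y : {set V}) (x y e : E) (u v w : V).

Lemma endsP e : exists u v, ends e = [set u; v].
Proof.
have /andP[gt0] := ends_card e; rewrite leq_eqVlt ltnS => /orP[/cards2P|le1].
  by case=> u [v [_ ->]]; exists u, v.
have /cards1P[u ->] : #|ends e| == 1 by rewrite eqn_leq le1.
by exists u, u; rewrite setUid.
Qed.

Lemma in_delta X e u v :
  ends e = [set u; v] -> (e \in delta X) = (u \in X) (+) (v \in X).
Proof.
move=> eE; rewrite inE eE cards2; case: (eqVneq u v) => [->|uv] /=.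
  by rewrite addbb.
rewrite setIUl; case uX: (u \in X); case vX: (v \in X) => /=.
- by rewrite !(setIidPl _) ?sub1set // cards2 uv.
- rewrite (setIidPl _) ?sub1set // (_ : [set v] :&: X = set0) ?setU0 ?cards1 //.
  by apply/eqP; rewrite setI_eq0 disjoints1 vX.
- rewrite setUC (setIidPl _) ?sub1set // (_ : [set u] :&: X = set0) ?setU0 ?cards1 //.
  by apply/eqP; rewrite setI_eq0 disjoints1 uX.
- rewrite (_ : [set u] :&: X = set0) ?set0U; last first.
    by apply/eqP; rewrite setI_eq0 disjoints1 uX.
  rewrite (_ : [set v] :&: X = set0) ?cards0 //.
  by apply/eqP; rewrite setI_eq0 disjoints1 vX.
Qed.

Lemma delta_addb X Y e :
  (e \in delta [set w | (w \in X) (+) (w \in Y)])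
    = (e \in delta X) (+) (e \in delta Y).
Proof.
have [u [v eE]] := endsP e; rewrite !(in_delta _ eE) !inE.
by rewrite addbACA.
Qed.

Lemma cycle_delta Z X x : cycle_edges Z -> Z :&: delta X <> [set x].
Proof.
case=> k [v [e [k0 _ einj eE ->]]] ZXx.
have /setIP[/imsetP[i0 _ xi0] _] : x \in [set e i | i : 'I_k] :&: delta X.
  by rewrite ZXx set11.
have dE i : (e i \in delta X) = (i == i0).
  have := in_set1 (e i) x; rewrite -ZXx in_setI imset_f //= => ->.
  by rewrite xi0 (inj_eq einj).
(* Parity: around the cycle, the side of [X] changes an even number of times. *)
have : \big[addb/false]_(i < k) (e i \in delta X) = true.
  rewrite (bigD1 i0) //= dE eqxx big1 // => i ii0.
  by rewrite dE (negPf ii0).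
rewrite (eq_bigr (fun i => (v i \in X) (+) (v (ordS i) \in X))); last first.
  by move=> i _; apply: in_delta.
rewrite big_split /= [in X in X (+) _](reindex_inj (@ordS_inj k)) /=.
by rewrite addbb.
Qed.

(** For [x = e i] and [y = e j] with [i < j], take as [X] the arc of vertices after [v i] up to
    [v j]: the cycle enters it by [e i] and leaves it by [e j]. *)
Lemma cycle_delta_pair Z x y :
    cycle_edges Z -> x \in Z -> y \in Z -> x != y ->
  exists X, Z :&: delta X = [set x; y].
Proof.
case=> k [v [e [k0 vinj einj eE ->]]] /imsetP[i _ ->] /imsetP[j _ ->].
rewrite (inj_eq einj) => ij.
wlog ltij : i j ij / i < j.
  move=> th; case: (ltngtP i j) => [|ltji|/val_inj/eqP]; first exact: th.
    by rewrite setUC; apply: th => //; rewrite eq_sym.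
  by rewrite (negPf ij).
exists [set v t | t : 'I_k & i < t <= j].
have vX t : (v t \in [set v t | t : 'I_k & i < t <= j]) = (i < t <= j).
  by rewrite mem_imset // inE.
have dE t : (e t \in delta [set v t | t : 'I_k & i < t <= j])
              = (t == i) || (t == j).
  rewrite (in_delta _ (eE t)) !vX /= -!val_eqE /=.
  (* The last edge wraps around to vertex [0], which is outside the arc because [i < 0] fails; so it
     is in the cut only when [j] is the last index. *)
  have ltj := ltn_ord j; have := ltn_ord t; rewrite leq_eqVlt => /orP[/eqP tk|tk].
    have lejt : j <= t by rewrite -ltnS tk.
    have ltit := leq_trans ltij lejt.
    by rewrite tk modnn ltit (gtn_eqF ltit) /= addbF eqn_leq lejt andbT.
  rewrite modn_small // ltnS; case: (ltngtP t i) => [lti|lti|->] /=.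
  - by rewrite ltn_eqF // (ltn_trans lti).
  - by rewrite leq_eqVlt; case: (ltngtP t j).
  - by rewrite ltij.
apply/setP => z; rewrite in_setI in_set2; apply/andP/orP.
  by case=> /imsetP[t _ ->]; rewrite dE !(inj_eq einj) => /orP.
by case=> /eqP ->; rewrite dE eqxx ?orbT imset_f.
Qed.

Lemma cycle_neq0 Z : cycle_edges Z -> Z != set0.
Proof.
case=> k [v [e [k0 _ _ _ ->]]]; apply/set0Pn.
by exists (e (Ordinal k0)); apply: imset_f.
Qed.

(** If [y] were in [Z] but not in [Z'], a cut meeting [Z] in just [y] and some [x] of [Z'] would
    meet the cycle [Z'] in [x] alone, against parity. *)
Lemma cycle_minimal Z Z' :
  cycle_edges Z -> cycle_edges Z' -> Z' \subset Z -> Z' = Z.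
Proof.
move=> Zc Z'c sZ'Z; apply/eqP; rewrite eqEsubset sZ'Z; apply/subsetP => y yZ.
have /set0Pn[x xZ'] := cycle_neq0 Z'c.
apply/negPn/negP => yZ'.
have xy : x != y by apply: contraNneq yZ' => <-.
have [X ZX] := cycle_delta_pair Zc (subsetP sZ'Z x xZ') yZ xy.
apply: (@cycle_delta Z' X x Z'c).
rewrite -(setIidPl sZ'Z) -setIA ZX; apply/setP => z; rewrite !inE.
case: (eqVneq z x) => [->|zx] /=; first by rewrite xZ'.
by apply/andP => -[zZ' /eqP zy]; rewrite -zy zZ' in yZ'.
Qed.

(** * Connectivity, closing a path to a cycle, and bonds *)

Lemma adj_sym F : symmetric (adj F).
Proof.
by move=> u v; apply: eq_existsb => e; rewrite [[set u; v]]setUC.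
Qed.

Lemma connect_adj_sym F : connect_sym (adj F).
Proof. exact/sym_connect_sym/adj_sym. Qed.

Lemma connect_ends F e u v :
  e \in F -> ends e = [set u; v] -> connect (adj F) u v.
Proof.
by move=> eF eE; apply: connect1; apply/existsP; exists e; rewrite eF eE /=.
Qed.

Lemma connect_delta_disjoint F X u v :
    F :&: delta X = set0 -> connect (adj F) u v -> (u \in X) = (v \in X).
Proof.
move=> FX0; move: u v; apply: (closed_connect (a := mem X)) => u v.
case/existsP => e /andP[eF /eqP eE]; apply/eqP.
have := in_set0 e; rewrite -FX0 inE eF (in_delta _ eE) /=.
by rewrite -negb_eqb => /negbFE.
Qed.

Lemma path_cycle F x u v :
    x \notin F -> ends x = [set u; v] -> connect (adj F) u v ->
  exists2 Z, cycle_edges Z & Z \subset x |: F.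
Proof.
move=> xF xE /connectP[p0 /shortenP[p pth unq _] vp]; rewrite {}vp in xE.
pose q i := nth u (u :: p) i.
have q_inj i j : i <= size p -> j <= size p -> (q i == q j) = (i == j).
  by move=> ip jp; rewrite nth_uniq.
have le_size (i : 'I_(size p).+1) : i <= size p by rewrite -ltnS.
(* Edge [i] joins the path vertices [q i] and [q i.+1]; the last index [size p] is reserved for [x],
   which leads back to [q 0 = u]. *)
pose good (i : 'I_(size p).+1) e := ends e = [set q i; q (ordS i)] /\
  (if i == size p :> nat then e = x else e \in F).
have /fin_all_exists[f fE] : forall i, exists e, good i e.
  move=> i; rewrite /good /=; case: eqVneq => [->|ip].
    by exists x; rewrite modnn xE setUC /q -last_nth.
  have {}ip : i < size p by rewrite ltn_neqAle ip le_size.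
  have /pathP := pth; move/(_ u i ip)/existsP => [e /andP[eF /eqP eE]].
  by exists e; rewrite modn_small ?ltnS.
exists [set f i | i : 'I_(size p).+1]; last first.
  apply/subsetP => _ /imsetP[i _ ->]; rewrite !inE; have [_] := fE i.
  by case: eqP => [_ ->|_ ->]; rewrite ?eqxx ?orbT.
exists (size p).+1, (fun i => q (val i)), f; split=> //.
- by move=> i j /eqP; rewrite q_inj ?le_size // => /eqP/val_inj.
- move=> i j fij; apply: val_inj => /=; have [iE] := fE i; have [jE] := fE j.
  case: (eqVneq (j : nat) (size p)) => [->|jp] jF.
    by case: eqVneq => [->//|_]; rewrite fij jF (negPf xF).
  case: (eqVneq (i : nat) (size p)) => [ip iF|ip _].
    by rewrite -fij iF (negPf xF) in jF.
  have {}ip : i < size p by rewrite ltn_neqAle ip le_size.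
  have {}jp : j < size p by rewrite ltn_neqAle jp le_size.
  (* Two path edges with the same ends and [i != j] would force both [j = i.+1] and [i = j.+1]. *)
  move: iE jE; rewrite fij /= !modn_small ?ltnS // => -> /setP qE.
  have := qE (q i); have := qE (q j); rewrite !inE !eqxx /=.
  rewrite !q_inj ?(ltnW ip) ?(ltnW jp) //.
  case: (eqVneq (i : nat) j) => // _ /=; rewrite ?eqxx.
  move=> /eqP ji /esym /eqP ij.
  by move: (leqnSn i.+1); rewrite -ji -ij ji ltnn.
by move=> i; case: (fE i).
Qed.

(** The two cases are whether or not the ends of [x] stay connected in [F :\ x]. *)
Lemma cycle_or_bond F x :
    x \in F ->
  (exists2 Z, cycle_edges Z & Z \subset F) \/
  (exists2 B, bond B & F :&: B = [set x]).
Proof.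
move=> xF; have [u [v xE]] := endsP x.
have [cuv|ncuv] := boolP (connect (adj (F :\ x)) u v).
  left; have [|Z Zc] := path_cycle _ xE cuv; first by rewrite !inE eqxx.
  by rewrite setD1K //; exists Z.
(* A cut minimal among those meeting [F] in [x] alone is a bond: a proper
   subcut either contains [x], or can be removed by symmetric difference. *)
right; pose P D := (edge_cut D) && (F :&: D == [set x]).
pose X := [set w | connect (adj (F :\ x)) u w].
have PX : P (delta X).
  apply/andP; split; first by apply/existsP; exists X.
  apply/eqP/setP => e; rewrite in_set1 in_setI.
  have [->|ex] := eqVneq e x.
    by rewrite xF (in_delta _ xE) !inE connect0 (negPf ncuv).
  apply/andP => -[eF]; have [a [b eE]] := endsP e.
  have cab : connect (adj (F :\ x)) a b by apply: connect_ends eE; rewrite !inE ex.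
  rewrite (in_delta _ eE) !inE.
  by rewrite (same_connect_r (connect_adj_sym _) cab) addbb.
have [B /minsetP[/andP[/existsP[Y /eqP BY] /eqP FB] Bmin] _] :=
  minset_exists (P := P) PX.
have xB : x \in B by have := set11 x; rewrite -FB => /setIP[].
exists B => //; apply/minsetP; split.
  apply/andP; split; first by apply/set0Pn; exists x.
  by apply/existsP; exists Y; rewrite BY.
move=> D /andP[D0 /existsP[X' /eqP DX']] sDB.
have [xD|xD] := boolP (x \in D).
  apply: Bmin => //; apply/andP; split; first by apply/existsP; exists X'; rewrite DX'.
  rewrite eqEsubset -{1}FB setIS //= sub1set inE xF xD //.
pose D' := delta [set w | (w \in Y) (+) (w \in X')].
have D'E e : (e \in D') = (e \in B) && (e \notin D).
  rewrite /D' delta_addb -BY -DX'; case eD : (e \in D) => /=.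
    by rewrite (subsetP sDB).
  by rewrite addbF andbT.
have sD'B : D' \subset B by apply/subsetP => e; rewrite D'E => /andP[].
have D'B : D' = B.
  apply: Bmin => //; apply/andP; split.
    by apply/existsP; exists [set w | (w \in Y) (+) (w \in X')].
  by rewrite eqEsubset -{1}FB setIS //= sub1set inE xF D'E xB xD.
case/set0Pn: D0 => e eD; have := subsetP sDB e eD.
by rewrite -D'B D'E eD andbF.
Qed.

(** * Cobalanced partitions in terms of bonds avoiding an edge set *)

Lemma in_Ext F e u v :
    ends e = [set u; v] ->
  (e \in Ext (comp_partition F)) = ~~ connect (adj F) u v.
Proof.
have eqR : {in [set: V] & &, equivalence_rel (connect (adj F))}.
  move=> a b c _ _ _; split=> [|ab]; first exact: connect0.
  exact: (same_connect (connect_adj_sym F) ab).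
have pE a b : (pblock (comp_partition F) a == pblock (comp_partition F) b)
                = connect (adj F) a b.
  have /and3P[/eqP cov tr _] := equivalence_partitionP eqR.
  rewrite eq_pblock //; last by rewrite cov inE.
  by rewrite (pblock_equivalence_partition eqR) ?inE.
move=> eE; rewrite inE eE; apply/existsP/idP.
  case=> a; rewrite !inE => /andP[ae /existsP[b]]; rewrite !inE pE => /andP[be].
  case/orP: ae => /eqP ->; case/orP: be => /eqP ->; rewrite ?connect0 //.
  by rewrite connect_adj_sym.
move=> nc; exists u; rewrite !inE eqxx /=; apply/existsP; exists v.
by rewrite !inE eqxx orbT pE.
Qed.

(** A path in [F] between the ends of an edge of [delta X] would itself have to cross the cut. *)
Lemma Ext_delta F X :
  (delta X \subset Ext (comp_partition F)) = (F :&: delta X == set0).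
Proof.
apply/idP/eqP => [sX|FX0].
  apply/setP => e; rewrite in_set0 in_setI; apply/andP => -[eF /(subsetP sX)].
  by have [u [v eE]] := endsP e; rewrite (in_Ext _ eE) (connect_ends eF eE).
apply/subsetP => e; have [u [v eE]] := endsP e.
rewrite (in_Ext _ eE) (in_delta _ eE); apply: contraL => cuv.
by rewrite (connect_delta_disjoint FX0 cuv) addbb.
Qed.

Lemma bond_delta B : bond B -> exists X, B = delta X.
Proof. by case/minsetp/andP => _ /existsP[X /eqP ->]; exists X. Qed.

Lemma Ext_bond F B :
  bond B -> (B \subset Ext (comp_partition F)) = (F :&: B == set0).
Proof. by case/bond_delta => X ->; apply: Ext_delta. Qed.

Lemma cobalancedP (L : {set {set E}}) F :
  reflect (cobalanced L (comp_partition F))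
    [forall B, bond B ==> (F :&: B == set0) ==> (B \in L)].
Proof.
apply: (iffP forallP) => [cob B Bb|cob B].
  by rewrite Ext_bond // => FB0; have := cob B; rewrite Bb FB0.
by apply/implyP => Bb; apply/implyP; rewrite -Ext_bond //; apply: cob.
Qed.

(** * Passing between [E(G)] and [E(G) + e_0] *)

Lemma in_lift_set F e : (Some e \in lift_set F) = (e \in F).
Proof. by rewrite mem_imset //; apply: Some_inj. Qed.

Lemma None_lift_set F : None \notin lift_set F.
Proof. by apply/imsetP => -[]. Qed.

Lemma in_lift_set0 F e : (Some e \in lift_set0 F) = (e \in F).
Proof. by rewrite !inE in_lift_set. Qed.

Lemma None_lift_set0 F : None \in lift_set0 F.
Proof. by rewrite setU11. Qed.

Lemma lift_setS F F' : (lift_set F \subset lift_set F') = (F \subset F').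
Proof.
apply/idP/idP => [/subsetP sFF'|]; last exact: imsetS.
by apply/subsetP => e; rewrite -in_lift_set => /sFF'; rewrite in_lift_set.
Qed.

Lemma lift_set_sub0 F : lift_set F \subset lift_set0 F.
Proof. exact: subsetUr. Qed.

Lemma lift_set0S F F' : (lift_set0 F \subset lift_set0 F') = (F \subset F').
Proof.
apply/idP/idP => [/subsetP sFF'|sFF']; last by rewrite setUS ?lift_setS.
by apply/subsetP => e; rewrite -in_lift_set0 => /sFF'; rewrite in_lift_set0.
Qed.

Lemma lift_setE (C : {set option E}) :
  C = if None \in C then lift_set0 [set e | Some e \in C]
      else lift_set [set e | Some e \in C].
Proof.
by apply/setP => -[e|]; case: ifP => CN;
  rewrite ?in_lift_set0 ?None_lift_set0 ?in_lift_set ?(negPf (None_lift_set _)) ?inE.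
Qed.

End Graphs.

(** * Independent sets and circuits of the complete join matroid *)

Section JoinMatroid.
Variables (G : graph) (L : {set {set edge G}}) (M : matroid (option (edge G))).
Hypothesis joinM : complete_join_matroid L M.
Implicit Types B F J Z : {set edge G}.

(** Membership in [L] only decides whether [e_0] is added; the trace on [E(G)] is [B] in both
    cases. *)
Lemma bond_cocircuit B :
    bond B ->
  exists2 D, cocircuit M D & forall e, (Some e \in D) = (e \in B).
Proof.
move=> Bb; have [BL|BL] := boolP (B \in L).
  exists (lift_set B); last exact: in_lift_set.
  by apply/joinM/Or31; exists B; rewrite ?Bb.
exists (lift_set0 B); last exact: in_lift_set0.
by apply/joinM/Or32; exists B; rewrite ?Bb.
Qed.

(** Bonds, tribonds and dibonds are all unions of cuts [delta X]. *)
Lemma cocircuit_cut D e :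
    cocircuit M D -> Some e \in D ->
  exists2 X, e \in delta X & forall x, x \in delta X -> Some x \in D.
Proof.
case/joinM => [[B /andP[/bond_delta[X ->] _] ->]
             | [B /andP[/bond_delta[X ->] _] ->]
             | [T /andP[tdT _] ->]].
- by rewrite in_lift_set; exists X => // x; rewrite in_lift_set.
- by rewrite in_lift_set0; exists X => // x; rewrite in_lift_set0.
rewrite in_lift_set; case/orP: tdT.
  case/existsP => P /andP[_ /eqP->] /bigcupP[X XP eX]; exists X => // x xX.
  by rewrite in_lift_set; apply/bigcupP; exists X.
case/andP => /existsP[B1 /existsP[B2 /andP[/and3P[]]]].
case/bond_delta => X1 -> /bond_delta[X2 ->] _ /eqP-> _.
case/setUP => eX; [exists X1 | exists X2] => // x xX;
  by rewrite in_lift_set inE xX ?orbT.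
Qed.

(** Otherwise a fundamental cocircuit would meet [Z] in one edge [x], and so would a cut through [x]
    inside it, against parity. *)
Lemma cycle_dependent Z : cycle_edges Z -> ~~ independent M (lift_set Z).
Proof.
move=> Zc; apply/negP => Zind.
have /set0Pn[x xZ] := cycle_neq0 Zc.
have [|D Dc ZD] := fundamental_cocircuit Zind (x := Some x).
  by rewrite in_lift_set.
have [|X xX sXD] := cocircuit_cut (e := x) Dc.
  by have := set11 (Some x); rewrite -ZD => /setIP[].
apply: (@cycle_delta _ Z X x Zc); apply/eqP.
rewrite eqEsubset sub1set in_setI xZ xX !andbT.
apply/subsetP => z /setIP[zZ /sXD zD].
have := in_setI (Some z) (lift_set Z) D.
by rewrite ZD in_lift_set zZ zD !inE => /eqP[->].
Qed.

(** Take an edge [x] of a circuit inside [F]. If [F] contains no cycle, some bond meets [F] in [x]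
    alone, and its cocircuit contradicts orthogonality. *)
Lemma dependent_cycle F :
  ~~ independent M (lift_set F) -> exists2 Z, cycle_edges Z & Z \subset F.
Proof.
case/dependent_circuit => C Cc sCF; have /set0Pn[[x|] xC] := circuit_neq0 Cc;
  have := subsetP sCF _ xC; last by rewrite (negPf (None_lift_set _)).
rewrite in_lift_set => /cycle_or_bond[//|[B Bb FB]].
have [D Dc DE] := bond_cocircuit Bb.
case: (circuit_orthogonal (x := Some x) Cc Dc); apply/eqP.
have FBE z : (z \in F) && (z \in B) = (z == x) by rewrite -in_setI FB inE.
rewrite eqEsubset sub1set inE xC DE; apply/andP; split; last first.
  by have := FBE x; rewrite eqxx => /andP[].
apply/subsetP => -[z|] /setIP[/(subsetP sCF)]; last first.
  by rewrite (negPf (None_lift_set _)).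
by rewrite in_lift_set DE inE => zF zB; have := FBE z; rewrite zF zB => /esym/eqP->.
Qed.

Lemma forestP F : reflect (forest_edges F) (independent M (lift_set F)).
Proof.
apply: (iffP idP) => [Find Z Zc | Ff].
  apply: contra (cycle_dependent Zc) => sZF.
  by apply: independentS Find; rewrite lift_setS.
by apply: contraT => /dependent_cycle[Z /Ff /negP].
Qed.

Lemma forest_cobalancedP F :
    forest_edges F ->
  reflect (cobalanced L (comp_partition F)) (~~ independent M (lift_set0 F)).
Proof.
move/forestP => Find; apply: (iffP idP) => [Fdep|Fcob].
  apply/cobalancedP; apply/forallP => B; apply/implyP => Bb; apply/implyP => FB0.
  apply/negPn/negP => BL; have [C Cc sCF] := dependent_circuit Fdep.
  have Dc : cocircuit M (lift_set0 B).
    by apply/joinM/Or32; exists B; rewrite ?Bb.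
  (* A circuit avoiding [e_0] would lie in the forest [F], which is independent. *)
  have NC : None \in C.
    apply: contraLR (minsetp Cc) => NC; rewrite negbK.
    apply: independentS Find; apply/subsetP => -[e|] zC; last by rewrite zC in NC.
    by rewrite in_lift_set -in_lift_set0 (subsetP sCF).
  apply: (circuit_orthogonal (x := None) Cc Dc); apply/setP => -[e|]; last first.
    by rewrite in_setI NC None_lift_set0 inE.
  rewrite in_setI in_lift_set0 inE /=; apply/andP => -[/(subsetP sCF)].
  rewrite in_lift_set0 => eF eB.
  by have := in_set0 e; rewrite -(eqP FB0) inE eF eB.
apply/negP => F0ind.
have [D Dc FD] := fundamental_cocircuit F0ind (None_lift_set0 F).
have ND : None \in D by have := set11 (None : option (edge G)); rewrite -FD => /setIP[].
(* Only cocircuits [lift_set0 B] with [B] outside [L] contain [e_0]; since [D] meets [F + e_0] in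
   [e_0] alone, this [B] avoids [F]. *)
case/joinM: Dc ND FD => [[B _ ->]|[B /andP[Bb BL] ->] _ FB|[T _ ->]];
  rewrite ?(negPf (None_lift_set _)) //.
case/negP: BL; apply: Fcob => //; rewrite Ext_bond // -subset0.
apply/subsetP => e /setIP[eF eB].
have := in_setI (Some e) (lift_set0 F) (lift_set0 B).
by rewrite FB !in_lift_set0 eF eB inE.
Qed.

(** When [J] is a forest, a dependent subset of [J + e_0] must contain [e_0], so minimality among
    dependent sets becomes minimality among forests with cobalanced partition. *)
Lemma circuit_L_join J : circuit M (lift_set0 J) <-> L_join L J.
Proof.
split=> [/minsetP[Jdep Jmin] | [Jf Jcob Jmin]].
  have Jf : forest_edges J.
    (* Were [J] dependent, minimality would make the circuit equal to [lift_set J], which lacks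
       [e_0]. *)
    apply/forestP; apply: contraT => dep; have := None_lift_set J.
    by rewrite (Jmin _ dep (lift_set_sub0 J)) None_lift_set0.
  split=> // [|J' J'f /(forest_cobalancedP J'f) dep sJ'J].
    exact/(forest_cobalancedP Jf).
  have /setP eJ : lift_set0 J' = lift_set0 J by apply: Jmin; rewrite ?lift_set0S.
  by apply/setP => e; rewrite -!in_lift_set0 eJ.
apply/minsetP; split; first exact/(forest_cobalancedP Jf).
move=> C; rewrite (lift_setE C); case: ifP => _;
  move: [set _ | _] => J' J'dep.
  rewrite lift_set0S => sJ'J; congr (lift_set0 _).
  have J'f : forest_edges J' by move=> Z /Jf; apply/contra => /subset_trans->.
  exact: Jmin J'f (elimT (forest_cobalancedP J'f) J'dep) sJ'J.
move=> sJ'J; case/negP: J'dep; apply: independentS (introT (forestP J) Jf).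
apply/subsetP => -[e eJ'|]; last by rewrite (negPf (None_lift_set J')).
by rewrite in_lift_set -in_lift_set0 (subsetP sJ'J).
Qed.

(** Among subsets of [E(G)], the dependent ones are those containing a cycle, and no cycle properly
    contains another. *)
Lemma circuit_cycle Z : circuit M (lift_set Z) <-> cycle_edges Z.
Proof.
split=> [/minsetP[Zdep Zmin] | Zc].
  have [Z' Z'c sZ'Z] := dependent_cycle Zdep.
  suff -> : Z = Z' by [].
  have /setP eZ : lift_set Z' = lift_set Z.
    by apply: Zmin; [apply: cycle_dependent | rewrite lift_setS].
  by apply/setP => e; rewrite -!in_lift_set eZ.
apply/minsetP; split=> [|C Cdep sCZ]; first exact: cycle_dependent.
move: Cdep sCZ; rewrite (lift_setE C); case: ifP => _ Cdep sCZ.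
  by have := subsetP sCZ _ (None_lift_set0 _); rewrite (negPf (None_lift_set _)).
have [Z' Z'c sZ'C] := dependent_cycle Cdep; rewrite lift_setS in sCZ.
have eZ := cycle_minimal Zc Z'c (subset_trans sZ'C sCZ).
by congr (lift_set _); apply/eqP; rewrite eqEsubset sCZ -{1}eZ.
Qed.

End JoinMatroid.

Theorem theorem3p9 (G : graph) (L : {set {set edge G}})
    (M : matroid (option (edge G))) :
  linear_class L -> ~ trivial_class L -> complete_join_matroid L M ->
  forall C : {set option (edge G)},
    circuit M C <->
    (exists2 J : {set edge G}, L_join L J & C = lift_set0 J) \/
    (exists2 Z : {set edge G}, cycle_edges Z & C = lift_set Z).
Proof.
move=> _ _ joinM C; split=> [|[[J JL ->]|[Z Zc ->]]].
- rewrite (lift_setE C); case: ifP => _ Cc; [left | right].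
    by exists [set e | Some e \in C]; first exact/(circuit_L_join joinM).
  by exists [set e | Some e \in C]; first exact/(circuit_cycle joinM).
- exact/(circuit_L_join joinM).
- exact/(circuit_cycle joinM).
Qed.
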